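(* Let $\mathcal{H}$ be a real or complex Hilbert space. For any pair of proper nontrivial subspaces $\mathcal{F}$ and $\mathcal{G}$ of $\mathcal{H}$: 1. $\hat{\Theta}(\mathcal{F},\mathcal{G}^\perp)=\pi/2-\hat{\Theta}(\mathcal{F},\mathcal{G})$; 2. $\hat{\Theta}(\mathcal{G},\mathcal{F})\setminus\{\pi/2\}=\hat{\Theta}(\mathcal{F},\mathcal{G})\setminus\{\pi/2\}$; 3. $\hat{\Theta}(\mathcal{F}^\perp,\mathcal{G})\setminus(\{0\}\cup\{\pi/2\})=\pi/2-\{\hat{\Theta}(\mathcal{F},\mathcal{G})\setminus(\{0\}\cup\{\pi/2\})\}$; 4. $\hat{\Theta}(\mathcal{F}^\perp,\mathcal{G}^\perp)\setminus(\{0\}\cup\{\pi/2\})=\hat{\Theta}(\mathcal{F},\mathcal{G})\setminus(\{0\}\cup\{\pi/2\})$; 5. $\hat{\Theta}(\mathcal{G},\mathcal{F}^\perp)\setminus\{0\}=\pi/2-\{\hat{\Theta}(\mathcal{F},\mathcal{G})\setminus\{\pi/2\}\}$; 6. $\hat{\Theta}(\mathcal{G}^\perp,\mathcal{F})\setminus\{\pi/2\}=\pi/2-\{\hat{\Theta}(\mathcal{F},\mathcal{G})\setminus\{0\}\}$; 7. $\hat{\Theta}(\mathcal{G}^\perp,\mathcal{F}^\perp)\setminus\{0\}=\hat{\Theta}(\mathcal{F},\mathcal{G})\setminus\{0\}$. Moreover, with $\mathfrak{M}_{00}=\mathcal{F}\cap\mathcal{G}$, $\mathfrak{M}_{01}=\mathcal{F}\cap\mathcal{G}^\perp$,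 $\mathfrak{M}_{10}=\mathcal{F}^\perp\cap\mathcal{G}$, $\mathfrak{M}_{11}=\mathcal{F}^\perp\cap\mathcal{G}^\perp$, the multiplicities of the angles $\theta=0$ and $\theta=\pi/2$ are as follows (multiplicity of $0$; multiplicity of $\pi/2$): - in $\hat{\Theta}(\mathcal{F},\mathcal{G})$: $\dim\mathfrak{M}_{00}$; $\dim\mathfrak{M}_{01}$; - in $\hat{\Theta}(\mathcal{F},\mathcal{G}^\perp)$: $\dim\mathfrak{M}_{01}$; $\dim\mathfrak{M}_{00}$; - in $\hat{\Theta}(\mathcal{F}^\perp,\mathcal{G})$: $\dim\mathfrak{M}_{10}$; $\dim\mathfrak{M}_{11}$; - in $\hat{\Theta}(\mathcal{F}^\perp,\mathcal{G}^\perp)$: $\dim\mathfrak{M}_{11}$; $\dim\mathfrak{M}_{10}$; - in $\hat{\Theta}(\mathcal{G},\mathcal{F})$: $\dim\mathfrak{M}_{00}$; $\dim\mathfrak{M}_{10}$; - in $\hat{\Theta}(\mathcal{G},\mathcal{F}^\perp)$: $\dim\mathfrak{M}_{10}$; $\dim\mathfrak{M}_{00}$; - in $\hat{\Theta}(\mathcal{G}^\perp,\mathcal{F})$: $\dim\mathfrak{M}_{01}$; $\dim\mathfrak{M}_{11}$; - in $\hat{\Theta}(\mathcal{G}^\perp,\mathcal{F}^\perp)$: $\dim\mathfrak{M}_{11}$; $\dim\mathfrak{M}_{01}$. Finally, the multiplicities of the point angles $\theta\in(0,\pi/2)$ in $\hat{\Theta}(\mathcal{F},\mathcal{G})$, $\hat{\Theta}(\mathcal{F}^\perp,\mathcal{G}^\perp)$,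 $\hat{\Theta}(\mathcal{G},\mathcal{F})$ and $\hat{\Theta}(\mathcal{G}^\perp,\mathcal{F}^\perp)$ are the same, and are equal to the multiplicities of the point angles $\pi/2-\theta\in(0,\pi/2)$ in $\hat{\Theta}(\mathcal{F},\mathcal{G}^\perp)$, $\hat{\Theta}(\mathcal{F}^\perp,\mathcal{G})$, $\hat{\Theta}(\mathcal{G},\mathcal{F}^\perp)$ and $\hat{\Theta}(\mathcal{G}^\perp,\mathcal{F})$.
   Context: A subspace means a closed linear manifold; nontrivial means different from $\{0\}$, proper means different from $\mathcal{H}$. $P_{\mathcal{F}}$ denotes the orthogonal projector onto $\mathcal{F}$; $(P_{\mathcal{F}}P_{\mathcal{G}})|_{\mathcal{F}}$ is the restriction to $\mathcal{F}$, regarded as an operator $\mathcal{F}\to\mathcal{F}$. $\Sigma(T)$ and $\Sigma_p(T)$ denote the spectrum and point spectrum (set of eigenvalues) of $T$. The set of angles from $\mathcal{F}$ to $\mathcal{G}$ is $$\hat{\Theta}(\mathcal{F},\mathcal{G})=\{\theta:\theta=\arccos(\sigma),\ \sigma\ge 0,\ \sigma^2\in\Sigma((P_{\mathcal{F}}P_{\mathcal{G}})|_{\mathcal{F}})\}\subseteq[0,\pi/2].$$ An angle $\theta\in\hat{\Theta}(\mathcal{F},\mathcal{G})$ is a point angle if $\cos^2(\theta)\in\Sigma_p((P_{\mathcal{F}}P_{\mathcal{G}})|_{\mathcal{F}})$; its multiplicity is the multiplicity (dimension of the eigenspace) of $\cos^2(\theta)$ as an eigenvalue of $(P_{\mathcal{F}}P_{\mathcal{G}})|_{\mathcal{F}}$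 (multiplicity zero means it is not a point angle). For a set $S$ of reals, $\pi/2-S=\{\pi/2-s:s\in S\}$. Dimensions and multiplicities are either finite numbers or $\infty$; only finite versus infinite is distinguished. *)

(* Defs.v *)
From HB Require Import structures.
From mathcomp Require Import all_boot all_order all_algebra sesquilinear.
From mathcomp Require Import all_classical all_reals all_analysis.
From mathcomp Require Import complex.
Set Implicit Arguments.
Unset Strict Implicit.
Unset Printing Implicit Defensive.
Import Order.TTheory GRing.Theory Num.Theory.
Import numFieldNormedType.Exports.
Local Open Scope classical_set_scope.
Local Open Scope ring_scope.

Inductive scalar_kind := RealScalars | ComplexScalars.

(* The scalar field of a "real or complex" Hilbert space, with its conjugation
   and the embedding of the reals. *)
Definition scalars (R : realType) (k : scalar_kind) : numFieldType :=
  match k with RealScalars => R | ComplexScalars => R[i] end.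

Definition conj_scalar (R : realType) (k : scalar_kind) :
    {rmorphism scalars R k -> scalars R k} :=
  match k return {rmorphism scalars R k -> scalars R k} with
  | RealScalars => @idfun R
  | ComplexScalars => @conjc R
  end.

Definition of_real (R : realType) (k : scalar_kind) :
    {rmorphism R -> scalars R k} :=
  match k return {rmorphism R -> scalars R k} with
  | RealScalars => @idfun R
  | ComplexScalars => real_complex R
  end.

Definition is_subspace (K : numFieldType) (H : normedModType K) (F : set H) :=
  submod_closed [pred x | x \in F] /\ closed F.

Definition is_basis (K : numFieldType) (H : lmodType K) (V : set H) (n : nat)
    (b : 'I_n -> H) :=
  [/\ forall i, V (b i),
      forall c : 'I_n -> K, \sum_(i < n) c i *: b i = 0 -> forall i, c i = 0
    & forall x, V x -> exists c : 'I_n -> K, x = \sum_(i < n) c i *: b i].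

(* [Some n] is the finite dimension n, [None] is infinite dimension. *)
Definition dimension (K : numFieldType) (H : lmodType K) (V : set H) :
    option nat :=
  xget None [set Some n | n in [set n | exists b : 'I_n -> H, is_basis V b]].

(* An operator F -> F on a subspace F of H is represented by a function on H
   of which only the values on F matter. *)
Definition bounded_operator_on (K : numFieldType) (H : normedModType K)
    (F : set H) (T : H -> H) :=
  [/\ forall x, F x -> F (T x),
      forall (a : K) x y, F x -> F y -> T (a *: x + y) = a *: T x + T y
    & exists M : K, forall x, F x -> `|T x| <= M * `|x|].

Definition spectrum_on (K : numFieldType) (H : normedModType K)
    (F : set H) (T : H -> H) : set K :=
  [set l | ~ exists S : H -> H, bounded_operator_on F S /\
     forall x, F x -> S (T x - l *: x) = x /\ T (S x) - l *: S x = x].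

Definition eigenspace_on (K : numFieldType) (H : normedModType K)
    (F : set H) (T : H -> H) (l : K) : set H :=
  [set x | F x /\ T x = l *: x].

Definition point_spectrum_on (K : numFieldType) (H : normedModType K)
    (F : set H) (T : H -> H) : set K :=
  [set l | exists x, eigenspace_on F T l x /\ x <> 0].

Definition orthocomplement (R : realType) (k : scalar_kind)
    (H : normedModType (scalars R k)) (dot : {dot H for conj_scalar R k})
    (F : set H) : set H :=
  [set x | forall y, F y -> dot x y = 0].

(* The component y \in F in the decomposition x = y + (x - y) along F and its
   orthocomplement. *)
Definition projector (R : realType) (k : scalar_kind)
    (H : normedModType (scalars R k)) (dot : {dot H for conj_scalar R k})
    (F : set H) (x : H) : H :=
  xget 0 [set y | F y /\ orthocomplement dot F (x - y)].

Definition angles (R : realType) (k : scalar_kind)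
    (H : normedModType (scalars R k)) (dot : {dot H for conj_scalar R k})
    (F G : set H) : set R :=
  [set theta | exists s : R, [/\ theta = acos s, 0 <= s &
     spectrum_on F (projector dot F \o projector dot G)
       (of_real R k (s ^+ 2))]].

Definition point_angles (R : realType) (k : scalar_kind)
    (H : normedModType (scalars R k)) (dot : {dot H for conj_scalar R k})
    (F G : set H) : set R :=
  [set theta | angles dot F G theta /\
     point_spectrum_on F (projector dot F \o projector dot G)
       (of_real R k (cos theta ^+ 2))].

Definition multiplicity (R : realType) (k : scalar_kind)
    (H : normedModType (scalars R k)) (dot : {dot H for conj_scalar R k})
    (F G : set H) (theta : R) : option nat :=
  if `[< point_angles dot F G theta >] then
    dimension (eigenspace_on F (projector dot F \o projector dot G)
      (of_real R k (cos theta ^+ 2)))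
  else Some 0%N.

(* pi/2 - S *)
Definition pihalf_sub (R : realType) (S : set R) : set R :=
  [set pi / 2 - s | s in S].

(* Main.v *)
Require Import Defs.
From HB Require Import structures.
From mathcomp Require Import all_boot all_order all_algebra sesquilinear.
From mathcomp Require Import all_classical all_reals all_analysis.
From mathcomp Require Import complex ring lra.
Set Implicit Arguments.
Unset Strict Implicit.
Unset Printing Implicit Defensive.
Import Order.TTheory GRing.Theory Num.Theory.
Import numFieldNormedType.Exports.
Local Open Scope classical_set_scope.
Local Open Scope ring_scope.

(** Write P and Q for the projectors onto F and G, and T = PQ for the
    compression F -> F, whose spectrum is the set of cos^2 of the angles.  All
    the relations come from two symmetries of T.

    Complement.  On F the compression built from the orthocomplement of G is
    P(1 - Q) = 1 - T.  Its spectrum is one minus that of T, and the two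
    operators have the same eigenspaces.  Since 1 - cos^2 t = cos^2(pi/2 - t),
    replacing G by its orthocomplement reflects angles about pi/4
    ([spectrum_perp], [angles_perp], [multiplicity_perp]).

    Exchange.  With A = P restricted to G and B = Q restricted to F, the
    compressions of the pairs (F, G) and (G, F) are AB and BA.  These have the
    same spectrum away from 0, and for l <> 0 the map A sends the l-eigenspace
    of BA isomorphically onto that of AB.  Hence exchanging F and G preserves
    all angles other than pi/2, with multiplicity ([spectrum_sym],
    [dimension_eigenspace_sym]).

    Every other pair is reached from (F, G) by composing these two moves; an
    endpoint 0 or pi/2 has to be left out exactly when an exchange is made at
    the angle pi/2.  Direct computation gives the multiplicity of pi/2, since
    Tx = 0 with x in F means |Qx|^2 = <Tx, x> = 0, and the complement move
    turns this into the multiplicity of 0.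

    Two analytic facts support this algebra.  Orthogonal projections onto
    closed subspaces exist, and T has no spectrum above 1: as s ranges over all
    nonnegative reals in the definition of angles, the bound is what makes s
    the cosine of an angle in [0, pi/2].  For l > 1, with P' = 1 - Q, the
    equation (l - T) y = v reads (l - 1) y + P P' y = v, and is solved by
    minimising |y - u|^2 + c |P' P y|^2 with c = 1 / (l - 1) and u = c v.
    Projection onto a closed subspace is the same minimisation with c = 0, so
    both facts follow from one lemma, [least_squares]. *)

(** * Bounded operators, spectra and dimension *)

Section Operators.
Variables (K : numFieldType) (H : normedModType K).
Implicit Types (F G : set H) (T S A B : H -> H) (l : K).

Definition linear_set F := F 0 /\ forall a x y, F x -> F y -> F (a *: x + y).

Lemma linear_setZ F a x : linear_set F -> F x -> F (a *: x).
Proof. by move=> [F0 FP] Fx; rewrite -[_ *: _]addr0; exact: FP. Qed.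

Lemma linear_setD F x y : linear_set F -> F x -> F y -> F (x + y).
Proof. by move=> [_ FP] Fx Fy; rewrite -[x]scale1r; exact: FP. Qed.

Lemma linear_setN F x : linear_set F -> F x -> F (- x).
Proof. by move=> Fl Fx; rewrite -scaleN1r; exact: linear_setZ. Qed.

Lemma linear_setB F x y : linear_set F -> F x -> F y -> F (x - y).
Proof. by move=> Fl Fx Fy; apply: linear_setD => //; exact: linear_setN. Qed.

(** For [F = G] this is convertible to [bounded_operator_on F]; two different
    ends are needed to factor a compression through the other subspace. *)
Definition bounded_between F G T :=
  [/\ forall x, F x -> G (T x),
      forall (a : K) x y, F x -> F y -> T (a *: x + y) = a *: T x + T y
    & exists M : K, forall x, F x -> `|T x| <= M * `|x|].

Lemma bounded_between_ge0 F G T : bounded_between F G T ->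
  exists2 M : K, 0 <= M & forall x, F x -> `|T x| <= M * `|x|.
Proof.
move=> [_ _ [M TM]]; exists `|M| => // x Fx.
have Mx := TM x Fx.
by rewrite -(normr_id x) -normrM ger0_norm // (le_trans _ Mx).
Qed.

Lemma bounded_between0 F G T : linear_set F -> bounded_between F G T -> T 0 = 0.
Proof.
move=> [F0 _] [_ TP _]; have := TP 1 0 0 F0 F0.
by rewrite scaler0 addr0 scale1r => /esym/(canRL (addKr _)); rewrite addNr.
Qed.

Lemma bounded_betweenD F G T x y : bounded_between F G T -> F x -> F y ->
  T (x + y) = T x + T y.
Proof. by move=> [_ TP _] Fx Fy; have := TP 1 x y Fx Fy; rewrite !scale1r. Qed.

Lemma bounded_betweenZ F G T a x : linear_set F -> bounded_between F G T ->
  F x -> T (a *: x) = a *: T x.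
Proof.
move=> Fl Tb Fx; have [F0 _] := Fl; have [_ TP _] := Tb.
by rewrite -[_ *: _]addr0 TP // (bounded_between0 Fl Tb) addr0.
Qed.

Lemma bounded_betweenB F G T x y : linear_set F -> bounded_between F G T ->
  F x -> F y -> T (x - y) = T x - T y.
Proof.
move=> Fl Tb Fx Fy; rewrite (bounded_betweenD Tb) //; last exact: linear_setN.
by rewrite -scaleN1r (bounded_betweenZ _ Fl Tb) // scaleN1r.
Qed.

Lemma bounded_between_comp F G E T S :
  bounded_between F G T -> bounded_between G E S -> bounded_between F E (S \o T).
Proof.
move=> Tb Sb; have [M M0 TM] := bounded_between_ge0 Tb.
have [N N0 SN] := bounded_between_ge0 Sb.
have [TF TP _] := Tb; have [SG SP _] := Sb.
split=> [x Fx|a x y Fx Fy|] /=; first exact/SG/TF.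
  by rewrite TP // SP //; exact: TF.
exists (N * M) => x Fx /=; apply: le_trans (SN _ (TF _ Fx)) _.
by rewrite -mulrA ler_wpM2l // TM.
Qed.

Lemma bounded_between_sub_id F a T : linear_set F -> bounded_between F F T ->
  bounded_between F F (fun x => a *: (T x - x)).
Proof.
move=> Fl Tb; have [TF TP [M TM]] := Tb.
split=> [x Fx|b x y Fx Fy|].
- by apply: linear_setZ => //; apply: linear_setB => //; exact: TF.
- by rewrite TP // opprD addrACA -scalerBr scalerDr !scalerA mulrC.
exists (`|a| * (M + 1)) => x Fx; rewrite normrZ -mulrA ler_wpM2l //.
by rewrite (le_trans (ler_normB _ _)) // mulrDl mul1r lerD2r TM.
Qed.

Lemma point_spectrum_spectrum F T l :
  linear_set F -> point_spectrum_on F T l -> spectrum_on F T l.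
Proof.
move=> Fl [x [[Fx Tx] x_neq0]] [S [Sb STx]]; apply: x_neq0.
by rewrite -(STx x Fx).1 Tx subrr (bounded_between0 Fl Sb).
Qed.

(** Surjective and bounded below: the inverse exists, and the lower bound makes
    it both well defined and bounded. *)
Lemma not_spectrum F T l (a : K) : linear_set F -> bounded_between F F T -> 0 < a ->
  (forall x, F x -> a * `|x| <= `|T x - l *: x|) ->
  (forall y, F y -> exists2 x, F x & T x - l *: x = y) ->
  ~ spectrum_on F T l.
Proof.
move=> Fl Tb a_gt0 Ta Tsurj; apply; have [TF TP _] := Tb.
have Tlin b x y : F x -> F y ->
    T (b *: x + y) - l *: (b *: x + y) = b *: (T x - l *: x) + (T y - l *: y).
  move=> Fx Fy; rewrite TP // scalerDr opprD addrACA scalerBr !scalerA.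
  by rewrite mulrC.
have Tinj x y : F x -> F y -> T x - l *: x = T y - l *: y -> x = y.
  move=> Fx Fy xy; apply: subr0_eq; apply/eqP; rewrite -normr_le0.
  rewrite -(pmulr_rle0 _ a_gt0); apply: le_trans (Ta _ (linear_setB Fl Fx Fy)) _.
  have -> : x - y = -1 *: y + x by rewrite scaleN1r addrC.
  by rewrite Tlin // scaleN1r xy addNr normr0.
pose S y := xget 0 [set x | F x /\ T x - l *: x = y].
have SP y : F y -> F (S y) /\ T (S y) - l *: S y = y.
  move=> Fy; rewrite /S; case: xgetP => // nex.
  by have [x Fx Txy] := Tsurj y Fy; have [] := nex x.
have Fsub x : F x -> F (T x - l *: x).
  by move=> Fx; apply: linear_setB => //; [exact: TF|exact: linear_setZ].
exists S; split; last first.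
  move=> x Fx; split; last exact: (SP x Fx).2.
  by apply: Tinj => //; [apply: (SP _ _).1|apply: (SP _ _).2]; exact: Fsub.
split=> [x /SP[]//|b x y Fx Fy|].
  have [SFx Sx] := SP x Fx; have [SFy Sy] := SP y Fy.
  have [SFxy Sxy] := SP _ (Fl.2 b x y Fx Fy).
  apply: Tinj => //; first exact: Fl.2.
  by rewrite Sxy Tlin // Sx Sy.
exists a^-1 => x Fx; rewrite ler_pdivlMl //.
by have [SFx Sx] := SP x Fx; rewrite -{2}Sx Ta.
Qed.

(** [U - (1 - l)] is the opposite of [T - l], so their inverses are opposite. *)
Lemma spectrum_one_minus F T U l :
  linear_set F -> bounded_between F F T -> (forall x, F x -> U x = x - T x) ->
  spectrum_on F T l -> spectrum_on F U (1 - l).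
Proof.
move=> Fl Tb UT; apply: contra_not => -[S [Sb SP]].
have [TF _ _] := Tb; have [SF SL [M SM]] := Sb.
have UE x : F x -> U x - (1 - l) *: x = - (T x - l *: x).
  move=> Fx; rewrite UT // scalerBl scale1r !opprB.
  by rewrite [LHS]addrC addrA subrK.
exists (fun x => - S x); split.
  split=> [x Fx|a x y Fx Fy|]; first by apply: linear_setN => //; exact: SF.
    by rewrite SL // opprD scalerN.
  by exists M => x Fx; rewrite normrN SM.
move=> x Fx; have SFx := SF x Fx; split.
  have Fx' : F (T x - l *: x).
    by apply: linear_setB => //; [exact: TF|exact: linear_setZ].
  rewrite -[- S _]scaleN1r -(bounded_betweenZ _ Fl Sb) // scaleN1r -UE //.
  exact: (SP x Fx).1.
rewrite -[- S x]scaleN1r (bounded_betweenZ _ Fl Tb) // !scaleN1r scalerN.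
by rewrite -opprD -UE // (SP x Fx).2.
Qed.

(** If [S] inverts [B A - l] on [G], then [l^-1 (A S B - 1)] inverts [A B - l]
    on [F]. *)
Lemma spectrum_swap F G A B l : linear_set F -> linear_set G ->
  bounded_between G F A -> bounded_between F G B -> l != 0 ->
  spectrum_on F (A \o B) l -> spectrum_on G (B \o A) l.
Proof.
move=> Fl Gl Ab Bb l_neq0; apply: contra_not => -[S [Sb SP]].
have [AF _ _] := Ab; have [BG _ _] := Bb; have [SG _ _] := Sb.
have ASBb : bounded_between F F (A \o S \o B).
  by apply: bounded_between_comp Bb _; exact: bounded_between_comp Sb Ab.
exists (fun x => l^-1 *: ((A \o S \o B) x - x)).
split; first exact: bounded_between_sub_id.
move=> x Fx /=; have ABx := AF _ (BG _ Fx).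
have SBx := SG _ (BG _ Fx); split.
  rewrite (bounded_betweenB Fl Bb) ?(bounded_betweenZ _ Fl Bb) //; last first.
    exact: linear_setZ.
  rewrite (SP _ (BG _ Fx)).1 opprB addrCA subrr addr0.
  by rewrite scalerA mulVf // scale1r.
have ASBx := AF _ SBx.
have ASBxx := linear_setB Fl ASBx Fx.
rewrite (bounded_betweenZ _ Fl Bb) // (bounded_betweenZ _ Gl Ab); last exact: BG.
rewrite (bounded_betweenB Fl Bb) // (bounded_betweenB Gl Ab); try exact: BG.
have := (SP _ (BG _ Fx)).2 => /= /(canRL (subrK _)) ->.
rewrite (bounded_betweenD Ab) ?(bounded_betweenZ _ Gl Ab) //; try exact: BG; last first.
  exact: linear_setZ.
rewrite addrAC subrr add0r !scalerA mulVf // mulfV // !scale1r.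
by rewrite opprB addrCA subrr addr0.
Qed.

Lemma is_basis_image F G n (b : 'I_n -> H) (f g : {linear H -> H}) :
  (forall x, F x -> G (f x)) -> (forall y, G y -> F (g y)) ->
  (forall x, F x -> g (f x) = x) -> (forall y, G y -> f (g y) = y) ->
  linear_set F -> is_basis F b -> is_basis G (f \o b).
Proof.
move=> fG gF gfK fgK Fl [bF b_free b_span].
have f_sum c : \sum_(i < n) c i *: (f \o b) i = f (\sum_(i < n) c i *: b i).
  by rewrite linear_sum; apply: eq_bigr => i _; rewrite linearZ.
have sumF (c : 'I_n -> K) : F (\sum_(i < n) c i *: b i).
  apply: (big_ind F); [exact: Fl.1|by move=> *; exact: linear_setD|].
  by move=> i _; exact: linear_setZ.
split=> [i|c|y Gy]; first exact: fG.
  rewrite f_sum => fc0; apply: b_free.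
  by rewrite -[LHS]gfK // fc0 linear0.
have [c gy] := b_span _ (gF y Gy).
by exists c; rewrite f_sum -gy fgK.
Qed.

Lemma dimension_iso F G (f g : {linear H -> H}) :
  linear_set F -> linear_set G ->
  (forall x, F x -> G (f x)) -> (forall y, G y -> F (g y)) ->
  (forall x, F x -> g (f x) = x) -> (forall y, G y -> f (g y) = y) ->
  dimension F = dimension G.
Proof.
move=> Fl Gl fG gF gfK fgK; rewrite /dimension; congr (xget _ (_ @` _)).
apply/seteqP; split=> n [b b_basis].
  by exists (f \o b); exact: (is_basis_image fG gF gfK fgK Fl b_basis).
by exists (g \o b); exact: (is_basis_image gF fG fgK gfK Gl b_basis).
Qed.

Lemma dimension0 : dimension ([set 0] : set H) = Some 0%N.
Proof.
rewrite /dimension; case: xgetP => [d _ [n [b [b0 b_free _]] <-]|/(_ (Some 0%N))[]].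
  congr Some; case: n b b0 b_free => // n b b0 /(_ (fun _ => 1)) b_free.
  have /b_free/(_ ord0)/eqP : \sum_(i < n.+1) (1 : K) *: b i = 0.
    by rewrite big1 // => i _; rewrite b0 scaler0.
  by rewrite oner_eq0.
exists 0%N => //; exists (fun _ => 0); split=> //; first by move=> c _ [].
by move=> x ->; exists (fun _ => 0); rewrite big_ord0.
Qed.
End Operators.

(** * Real and complex scalars *)

Section ScalarField.
Variables (R : realType) (k : scalar_kind).
Local Notation K := (scalars R k).
Local Notation cj := (conj_scalar R k).
Local Notation rho := (of_real R k).

Lemma of_real_le (x y : R) : (rho x <= rho y) = (x <= y).
Proof. by case: k => //=; rewrite lecE /= eqxx. Qed.

Lemma of_real_lt (x y : R) : (rho x < rho y) = (x < y).
Proof. by case: k => //=; rewrite ltcE /= eqxx. Qed.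

Lemma ge0_of_real (a : K) : 0 <= a -> exists2 r : R, 0 <= r & a = rho r.
Proof.
case: k a => /= a; first by exists a.
case: a => a b; rewrite lecE /= => /andP[/eqP -> ?]; by exists a.
Qed.

Lemma sqr_norm_conj (a : K) : `|a| ^+ 2 = a * cj a.
Proof.
case: k a => /= a; last exact: sqr_normc.
by rewrite real_normK ?num_real.
Qed.

Lemma conj_real (r : R) : cj (rho r) = rho r.
Proof. by case: k => //=; rewrite oppr0. Qed.

End ScalarField.

(** * Inner products and regularised least squares *)

Section InnerProduct.
Variables (R : realType) (k : scalar_kind).
Variables (H : completeNormedModType (scalars R k)).
Variable dot : {dot H for conj_scalar R k}.
Hypothesis norm_dot : forall x : H, `|x| ^+ 2 = dot x x.
Local Notation K := (scalars R k).
Local Notation cj := (conj_scalar R k).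
Local Notation rho := (of_real R k).

Lemma dotC x y : dot x y = cj (dot y x).
Proof. by rewrite hermC expr0 mul1r. Qed.
Lemma dotDl x y z : dot (x + y) z = dot x z + dot y z.
Proof. exact: linearDl. Qed.
Lemma dotDr x y z : dot z (x + y) = dot z x + dot z y.
Proof. exact: linearDr. Qed.
Lemma dotBl x y z : dot (x - y) z = dot x z - dot y z.
Proof. exact: linearBl. Qed.
Lemma dotBr x y z : dot z (x - y) = dot z x - dot z y.
Proof. exact: linearBr. Qed.
Lemma dotZl a x z : dot (a *: x) z = a * dot x z.
Proof. exact: linearZl_LR. Qed.
Lemma dotZr a x z : dot z (a *: x) = cj a * dot z x.
Proof. exact: linearZr_LR. Qed.
Lemma dot0l z : dot 0 z = 0.
Proof. exact: linear0l. Qed.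

Lemma dot_eq0 x : dot x x = 0 -> x = 0.
Proof. by rewrite -norm_dot => /eqP; rewrite sqrf_eq0 normr_eq0 => /eqP. Qed.

Lemma dot_ge0 x : 0 <= dot x x.
Proof. by rewrite -norm_dot exprn_ge0. Qed.

Lemma dot_sym0 x y : dot x y = 0 -> dot y x = 0.
Proof. by move=> xy0; rewrite dotC xy0 rmorph0. Qed.

Lemma parallelogram (x y : H) :
  `|x + y| ^+ 2 + `|x - y| ^+ 2 = 2 * (`|x| ^+ 2 + `|y| ^+ 2).
Proof.
rewrite !norm_dot !(dotBl, dotBr, dotDl, dotDr).
move: (dot x x) (dot y y) (dot x y) (dot y x) => a b c d.
by ring.
Qed.

(** The functional [Q] is strongly convex, so a minimising family on [V] is
    Cauchy.  It is treated as a filter: the near-minimisers of [Q] with defect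
    below [e] form its base. *)
Section LeastSquares.
Variables (V : set H) (B : {linear H -> H}) (c : K) (u : H).
Hypotheses (V_lin : linear_set V) (V_closed : closed V).
Hypotheses (B_cont : continuous B) (c_ge0 : 0 <= c).

Let Q y : K := `|y - u| ^+ 2 + c * `|B y| ^+ 2.
Let D : set R := [set r | exists2 y, V y & Q y = rho r].

Let Q_ge0 y : 0 <= Q y.
Proof. by rewrite addr_ge0 ?mulr_ge0 ?exprn_ge0. Qed.

Let D_lb : lbound D 0.
Proof.
move=> r [y _ Qy]; have := Q_ge0 y.
by rewrite Qy -(rmorph0 (of_real R k)) of_real_le.
Qed.

Let Q_inf y : V y -> rho (inf D) <= Q y.
Proof.
move=> Vy; have [r _ Qr] := ge0_of_real (Q_ge0 y).
by rewrite Qr of_real_le; apply: ge_inf; [exists 0|exists y].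
Qed.

Let Q_near (e : R) : 0 < e -> exists2 y, V y & Q y < rho (inf D + e).
Proof.
move=> e_gt0; have D_inf : has_inf D.
  split; last by exists 0.
  have [r _ Qr] := ge0_of_real (Q_ge0 0).
  by exists r; exists 0 => //; case: V_lin.
have [r [y Vy Qy] rlt] := inf_adherent e_gt0 D_inf.
by exists y => //; rewrite Qy of_real_lt.
Qed.

(** The parallelogram law, applied to both terms of [Q], bounds the distance of
    two points by their excess over the infimum, since [Q] at their midpoint is
    at least the infimum. *)
Let Q_midpoint y z : V y -> V z ->
  `|y - z| ^+ 2 <= 2 * (Q y + Q z - 2 * rho (inf D)).
Proof.
move=> Vy Vz; set m := 2^-1 *: (y + z).
have Vm : V m by apply: linear_setZ => //; exact: linear_setD.
have two_m : 2 *: m = y + z by rewrite scalerA divff ?scale1r ?pnatr_eq0.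
have P1 := parallelogram (y - u) (z - u).
have P2 := parallelogram (B y) (B z).
rewrite -linearD -two_m linearZ normrZ exprMn normr_nat in P2.
rewrite (_ : y - u + (z - u) = 2 *: (m - u)) in P1; last first.
  by rewrite scalerBr two_m scaler_nat mulr2n opprD addrACA.
rewrite normrZ exprMn normr_nat in P1.
rewrite opprB addrA subrK in P1.
have -> : 2 * (Q y + Q z - 2 * rho (inf D)) = 4 * (Q m - rho (inf D)) +
    `|y - z| ^+ 2 + c * `|B y - B z| ^+ 2.
  rewrite /Q.
  move: P1 P2; set a := `|m - u| ^+ 2; set b := `|B m| ^+ 2.
  move=> /(canRL (addKr _)) -> /(canRL (addKr _)) ->; ring.
rewrite addrAC lerDr addr_ge0 ?mulr_ge0 ?exprn_ge0 //.
by rewrite subr_ge0 Q_inf.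
Qed.

Let Q_cont : continuous Q.
Proof.
move=> y.
have sqr_norm_cvg (f : H -> H) : f z @[z --> y] --> f y ->
    `|f z| ^+ 2 @[z --> y] --> `|f y| ^+ 2.
  by move=> fy; apply: cvgM; apply: cvg_norm.
apply: cvgD; last by apply: cvgM; [exact: cvg_cst|apply: sqr_norm_cvg; exact: B_cont].
by apply: (sqr_norm_cvg (fun z => z - u)); apply: cvgB => //; exact: cvg_cst.
Qed.

Let Q_min : exists2 y, V y & forall z, V z -> Q y <= Q z.
Proof.
pose E := filter_from [set e : R | 0 < e]
  (fun e => [set y | V y /\ Q y < rho (inf D + e)]).
have EF : ProperFilter E.
  apply: filter_from_proper.
    apply: filter_from_filter; first by exists 1 => /=.
    move=> e f /= e0 f0; exists (Num.min e f) => /=; first by rewrite lt_min e0.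
    move=> y [Vy Qy]; split; split => //; apply: lt_le_trans Qy _;
      by rewrite of_real_le lerD2l ge_min lexx ?orbT.
  by move=> e /= e0; have [y Vy Qy] := Q_near e0; exists y.
have Ec : cauchy E.
  apply: cauchy_exP => e e_gt0.
  have [r r0 er] := ge0_of_real (ltW e_gt0).
  have r_gt0 : 0 < r by rewrite -(of_real_lt k) -er rmorph0.
  have d_gt0 : 0 < r ^+ 2 / 4 by rewrite divr_gt0 ?exprn_gt0.
  have [y Vy Qy] := Q_near d_gt0.
  exists y; exists (r ^+ 2 / 4) => //= z [Vz Qz].
  rewrite -ball_normE /= -(@ltr_pXn2r _ 2) ?nnegrE ?(ltW e_gt0) //.
  apply: le_lt_trans (Q_midpoint Vy Vz) _.
  have -> : e ^+ 2 = 2 * (rho (inf D + r ^+ 2 / 4) + rho (inf D + r ^+ 2 / 4)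
      - 2 * rho (inf D)).
    rewrite er !rmorphD fmorph_div rmorphXn rmorph_nat.
    by field.
  by rewrite ltr_pM2l // ltrD2r ltrD.
have /cvg_ex[y Ey] : cvg E by exact/cauchy_cvgP.
have Vy : V y.
  apply: (@closed_cvg _ _ E _ id V V_closed _ y Ey).
  by exists 1 => //= z [].
exists y => // z Vz; apply: le_trans (Q_inf Vz).
have [q _ Qq] := ge0_of_real (Q_ge0 y).
rewrite Qq of_real_le; apply/ler_addgt0Pr => e e_gt0.
have e2 : 0 < e / 2 by rewrite divr_gt0.
have QE : Q @ E --> Q y by apply: continuous_cvg => //; exact: Q_cont.
have /cvgrPdist_lt/(_ (rho (e / 2))) := QE.
rewrite -{1}(rmorph0 (of_real R k)) of_real_lt => /(_ e2) near1.
have near2 : \forall z \near E, Q z < rho (inf D + e / 2).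
  by exists (e / 2) => //= t [].
have [t [/= t1 t2]] := filter_ex (filterI near1 near2).
have [s _ Qs] := ge0_of_real (Q_ge0 t).
move: t1 t2; rewrite Qs Qq of_real_lt => t1 t2.
have := le_lt_trans (real_ler_norm _) t1; rewrite -rmorphB /=.
have -> : rho (q - s) \is Num.real.
  by rewrite rmorphB realB // -?Qq -?Qs ger0_real.
rewrite of_real_lt => /(_ isT) {}t1; apply: ltW.
by rewrite -ltrBlDr; lra.
Qed.

(** The first variation of [Q] vanishes at its minimum.  If its value [g] in a
    direction [z] were nonzero, moving from [y] by [- t g z] with [t] small and
    positive would decrease [Q]: the change is [t |g|^2 (t p - 2)], where [p] is
    the second-order coefficient. *)
Lemma least_squares : exists2 y, V y & forall z, V z ->
  dot (y - u) z + c * dot (B y) (B z) = 0.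
Proof.
have [y Vy Qmin] := Q_min; exists y => // z Vz.
set g := dot (y - u) z + _; apply/eqP; apply: contraT => g_neq0.
have conj_c : cj c = c by have [r _ ->] := ge0_of_real c_ge0; exact: conj_real.
set p := `|z| ^+ 2 + c * `|B z| ^+ 2.
have p_ge0 : 0 <= p by rewrite addr_ge0 ?mulr_ge0 ?exprn_ge0.
have [r r_ge0 pr] := ge0_of_real p_ge0.
(* This step makes [t p < 1], so the first-order gain dominates. *)
set t := rho (1 + r)^-1.
have t_gt0 : 0 < t by rewrite -(rmorph0 (of_real R k)) of_real_lt invr_gt0 ltr_wpDr.
have conj_t : cj t = t by exact: conj_real.
have tp : t * (1 + p) = 1.
  rewrite pr -(rmorph1 (of_real R k)) -rmorphD -rmorphM /=.
  by rewrite mulVf ?rmorph1 // gt_eqF // ltr_wpDr.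
set a := - (t * g).
have conj_a : cj a = - (t * cj g) by rewrite rmorphN rmorphM conj_t.
have Qa : Q (y + a *: z) = Q y + (cj a * g + a * cj g) + (a * cj a) * p.
  have conj_g : cj g = dot z (y - u) + c * dot (B z) (B y).
    by rewrite rmorphD rmorphM conj_c -!dotC.
  rewrite /Q conj_g /g /p linearD linearZ /= !norm_dot.
  by rewrite !(dotBl, dotBr, dotDl, dotDr, dotZl, dotZr); ring.
have := Qmin _ (linear_setD V_lin Vy (linear_setZ a V_lin Vz)).
rewrite Qa -addrA lerDl conj_a.
have -> : - (t * cj g) * g + a * cj g + a * - (t * cj g) * p
  = - (t * (1 + t) * `|g| ^+ 2).
  have -> : 1 + t = 2 - t * p by rewrite -tp; ring.
  by rewrite sqr_norm_conj /a; ring.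
rewrite oppr_ge0 => /(lt_le_trans _)-/(_ 0); rewrite ltxx; apply.
by rewrite mulr_gt0 ?mulr_gt0 ?exprn_gt0 ?normr_gt0 // ltr_wpDr // ltW.
Qed.

End LeastSquares.

(** * Orthogonal projectors *)

Local Notation perp := (orthocomplement dot).

(** The form in which closedness enters the proof: the orthogonal decomposition
    exists.  Unlike closedness, it passes to the orthocomplement by pure algebra
    ([perp_complemented]). *)
Definition complemented (V : set H) :=
  linear_set V /\ forall x, exists2 y, V y & perp V (x - y).

Lemma perp_linear V : linear_set (perp V).
Proof.
split=> [y _|a x y Vx Vy z Vz]; first exact: dot0l.
by rewrite dotDl dotZl Vx // Vy // mulr0 addr0.
Qed.

Lemma perp_disjoint V x : V x -> perp V x -> x = 0.
Proof. by move=> Vx /(_ x Vx)/dot_eq0. Qed.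

(** The nearest point of [V] to [x] is the case [c = 0] of least squares. *)
Lemma subspace_complemented V : is_subspace V -> complemented V.
Proof.
move=> [[V0 VP] V_closed].
have V_lin : linear_set V.
  split=> [|a x y Vx Vy]; first by move: V0; rewrite !inE.
  by have := VP a x y; rewrite !inE; exact.
split=> // x.
have zero_cont : continuous (\0 : H -> H) by move=> y; exact: cvg_cst.
have [y Vy yP] := least_squares x V_lin V_closed zero_cont (lexx 0).
exists y => // z Vz; have /eqP := yP z Vz.
by rewrite mul0r addr0 -opprB linearNl oppr_eq0 => /eqP.
Qed.

Section Projector.
Variable V : set H.
Hypothesis V_compl : complemented V.
Let V_lin : linear_set V := V_compl.1.
Local Notation P := (projector dot V).

Lemma projectorP x : V (P x) /\ perp V (x - P x).
Proof.
rewrite /projector; case: xgetP => // nex.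
by have [y Vy yP] := V_compl.2 x; have [] := nex y.
Qed.

Lemma projector_in x : V (P x).
Proof. exact: (projectorP x).1. Qed.

Lemma projector_perp x : perp V (x - P x).
Proof. exact: (projectorP x).2. Qed.

Lemma projector_unique x y : V y -> perp V (x - y) -> P x = y.
Proof.
move=> Vy xyP; apply: subr0_eq; apply: (@perp_disjoint V).
  by apply: linear_setB => //; exact: projector_in.
have -> : P x - y = (x - y) - (x - P x) by rewrite opprB [RHS]addrC addrA subrK.
by apply: (@linear_setB _ _ (perp V)) => //; [exact: perp_linear|exact: projector_perp].
Qed.

Lemma projector_id x : V x -> P x = x.
Proof.
move=> Vx; apply: projector_unique => //; rewrite subrr.
by case: (perp_linear V).
Qed.

Lemma projector0 x : P x = 0 <-> perp V x.
Proof.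
split=> [Px0|xP]; first by have := projector_perp x; rewrite Px0 subr0.
by apply: projector_unique; [case: V_lin|rewrite subr0].
Qed.

Lemma projector_linear : linear P.
Proof.
move=> a x y; apply: projector_unique.
  by apply: V_lin.2; exact: projector_in.
rewrite opprD addrACA -scalerBr.
by apply: (perp_linear V).2; exact: projector_perp.
Qed.

Lemma projector_dot x y : dot (P x) y = dot (P x) (P y).
Proof.
rewrite -[in LHS](subrK (P y) y) dotDr.
rewrite (@dot_sym0 (y - P y)) ?add0r //.
by apply: projector_perp; exact: projector_in.
Qed.

Lemma projector_sym x y : dot (P x) y = dot x (P y).
Proof. by rewrite projector_dot dotC -projector_dot -dotC. Qed.

Lemma projector_norm x : `|P x| <= `|x|.
Proof.
rewrite -(@ler_pXn2r _ 2) ?nnegrE //.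
have [y yE] : exists y, y = x - P x by exists (x - P x).
have xE : x = y + P x by rewrite yE subrK.
have xP : dot y (P x) = 0 by rewrite yE; apply: projector_perp; exact: projector_in.
rewrite [in leRHS]xE [leRHS]norm_dot dotDl !dotDr xP (dot_sym0 xP).
by rewrite addr0 add0r -!norm_dot lerDr exprn_ge0.
Qed.

Lemma perp_perp : perp (perp V) = V.
Proof.
apply/seteqP; split=> x xP.
  have -> : x = P x.
    apply: subr0_eq; apply: (@perp_disjoint (perp V)).
      exact: projector_perp.
    apply: (@linear_setB _ _ (perp (perp V))) => //; first exact: perp_linear.
    by move=> y yP; apply: dot_sym0; apply: yP; exact: projector_in.
  exact: projector_in.
by move=> y yP; apply: dot_sym0; exact: yP.
Qed.

Lemma perp_complemented : complemented (perp V).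
Proof.
split=> [|x]; first exact: perp_linear.
exists (x - P x); first exact: projector_perp.
by rewrite perp_perp opprB addrC subrK; exact: projector_in.
Qed.
End Projector.

Lemma projectorC V x : complemented V ->
  projector dot (perp V) x = x - projector dot V x.
Proof.
move=> Vc; apply: projector_unique; first exact: perp_complemented.
  exact: projector_perp.
by rewrite perp_perp // opprB addrC subrK; exact: projector_in.
Qed.

(** * The compression of a projector to a subspace *)

Lemma projector_bounded F G : complemented G ->
  bounded_between F G (projector dot G).
Proof.
move=> Gc; split=> [x _|a x y _ _|]; [exact: projector_in|exact: projector_linear|].
by exists 1 => x _; rewrite mul1r projector_norm.
Qed.

(** The bundled form, which gives access to the theory of linear maps. *)
Definition projector_fun V (Vc : complemented V) : {linear H -> H} :=
  HB.pack (projector dot V)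
    (GRing.isLinear.Build K H H *:%R (projector dot V) (projector_linear Vc)).

Lemma projector_funE V (Vc : complemented V) : projector_fun Vc =1 projector dot V.
Proof. by []. Qed.

Lemma linear_contraction_continuous (f : {linear H -> H}) :
  (forall x, `|f x| <= `|x|) -> continuous f.
Proof.
move=> f_le; apply/linear_bounded_continuous/bounded_funP => r.
by exists r => x; exact: le_trans.
Qed.

Local Notation proj := (projector dot).

Section Pair.
Variables F G : set H.
Hypotheses (Fc : complemented F) (Gc : complemented G).

Lemma compression_bounded : bounded_between F F (proj F \o proj G).
Proof.
by apply: bounded_between_comp; exact: projector_bounded.
Qed.

Lemma compression_perp x : F x ->
  (proj F \o proj (perp G)) x = x - (proj F \o proj G) x.
Proof.
move=> Fx /=; rewrite projectorC // -!(projector_funE Fc) linearB.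
by rewrite [X in X - _]projector_funE projector_id.
Qed.

(** For [r > 1] put [a = r - 1 > 0].  Up to sign, [T - r] is [a] plus the
    positive operator [x |-> P (1 - Q) x], hence bounded below by [a]; and it is
    surjective by least squares with weight [a^-1] on [(1 - Q) P]. *)
Lemma spectrum_le1 (r : R) :
  spectrum_on F (proj F \o proj G) (rho r) -> r <= 1.
Proof.
rewrite leNgt => F_spec; apply/negP => r_gt1; move: F_spec.
set a := rho (r - 1).
have a_gt0 : 0 < a by rewrite -(rmorph0 rho) of_real_lt subr_gt0.
have Gc' := perp_complemented Gc.
have TE x : F x -> (proj F \o proj G) x - rho r *: x =
    - (a *: x + (proj F \o proj (perp G)) x).
  move=> Fx; rewrite compression_perp // /a rmorphB rmorph1 scalerBl scale1r.
  by rewrite addrA subrK opprB.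
have dotF x y : F y -> dot x (proj F y) = dot x y.
  by move=> Fy; rewrite projector_id.
apply: (not_spectrum Fc.1 compression_bounded a_gt0) => [x Fx|v Fv].
  rewrite TE // normrN; set w := (_ \o _) x.
  have w_ge0 : 0 <= dot w x.
    by rewrite /w /= (projector_sym Fc) (projector_id Fc Fx) (projector_dot Gc') dot_ge0.
  have dot_real : dot x w = dot w x.
    by rewrite dotC; have [s _ ->] := ge0_of_real w_ge0; exact: conj_real.
  have [s _ sr] := ge0_of_real (ltW a_gt0).
  rewrite -[a in leLHS]ger0_norm ?(ltW a_gt0) // -normrZ.
  rewrite -(@ler_pXn2r _ 2) ?nnegrE // !norm_dot dotDl !dotDr -addrA lerDl.
  rewrite dotZl dotZr dot_real /a conj_real addr_ge0 ?mulr_ge0 ?(ltW a_gt0) //.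
  by rewrite addr_ge0 ?mulr_ge0 ?(ltW a_gt0) ?dot_ge0.
(* Minimising over all of [H], with [P] inside [B]; the resulting equation
   itself puts the solution in [F]. *)
pose B : {linear H -> H} := projector_fun Gc' \o projector_fun Fc.
have B_cont : continuous B.
  apply: linear_contraction_continuous => x /=.
  by apply: le_trans (projector_norm Gc' _) _; exact: projector_norm.
have ai_ge0 : 0 <= a^-1 by rewrite invr_ge0 ltW.
have setT_lin : linear_set (setT : set H) by [].
have [y _ yP] := least_squares (- (a^-1 *: v)) setT_lin closedT B_cont ai_ge0.
have yE : a *: y + proj F (proj (perp G) (proj F y)) = - v.
  have : y + a^-1 *: v + a^-1 *: proj F (proj (perp G) (proj F y)) = 0.
    apply: dot_eq0; set w := y + _ + _.
    have := yP w I; rewrite opprK => <-.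
    rewrite {1}/w dotDl dotZl; congr (_ + _ * _).
    by rewrite /B /= (projector_sym Fc) (projector_dot Gc').
  move=> /(congr1 (fun z => a *: z)); rewrite !scalerDr !scalerA divff ?gt_eqF //.
  by rewrite !scale1r scaler0 addrAC => /eqP; rewrite addr_eq0 => /eqP.
have Fy : F y.
  have -> : y = a^-1 *: (- v - proj F (proj (perp G) (proj F y))).
    by rewrite -yE addrK scalerA mulVf ?scale1r // gt_eqF.
  apply: (linear_setZ _ Fc.1); apply: (linear_setB Fc.1).
    exact: (linear_setN Fc.1).
  exact: projector_in.
exists y => //; rewrite TE //= -[RHS]opprK -yE; congr (- (_ + _)).
by rewrite (projector_id Fc Fy).
Qed.

End Pair.

Lemma spectrum_perp F G (l : K) : complemented F -> complemented G ->
  spectrum_on F (proj F \o proj (perp G)) (1 - l) <->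
  spectrum_on F (proj F \o proj G) l.
Proof.
move=> Fc Gc; have Gc' := perp_complemented Gc; split=> [|F_spec]; last first.
  apply: spectrum_one_minus F_spec; [exact: Fc.1|exact: compression_bounded|].
  exact: compression_perp.
move/(@spectrum_one_minus _ _ _ _ (proj F \o proj G)); rewrite subKr; apply.
- exact: Fc.1.
- exact: compression_bounded.
- by move=> x Fx; rewrite compression_perp // subKr.
Qed.

Lemma spectrum_sym F G (l : K) : complemented F -> complemented G -> l != 0 ->
  spectrum_on G (proj G \o proj F) l <-> spectrum_on F (proj F \o proj G) l.
Proof.
move=> Fc Gc l_neq0.
by split; apply: spectrum_swap => //; try exact: projector_bounded;
  [exact: Gc.1|exact: Fc.1|exact: Fc.1|exact: Gc.1].
Qed.

(** * Angles and multiplicities *)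

Lemma cos_sqr_pihalfB (t : R) : cos (pi / 2 - t) ^+ 2 = 1 - cos t ^+ 2.
Proof. by rewrite cosB cos_pihalf sin_pihalf mul0r add0r mul1r sin2cos2. Qed.

(** Since the spectrum is bounded by 1, [acos] is only met between 0 and 1,
    where [cos] inverts it. *)
Lemma anglesP F G t : complemented F -> complemented G ->
  angles dot F G t <-> 0 <= t <= pi / 2 /\
    spectrum_on F (proj F \o proj G) (rho (cos t ^+ 2)).
Proof.
move=> Fc Gc; have pi_gt0 := pi_gt0 R; split=> [[s [-> s_ge0 s_spec]]|].
  have s_le1 : s <= 1.
    by rewrite -(expr_le1 (n := 2)) //; exact: spectrum_le1 s_spec.
  have s_itv : -1 <= s <= 1 by rewrite s_le1 andbT; lra.
  rewrite acosK ?in_itv //; split=> //; rewrite acos_ge0 //=.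
  rewrite leNgt -ltr_cos ?in_itv /= ?acos_ge0 ?acos_lepi //; last by lra.
  by rewrite cos_pihalf acosK ?in_itv // -leNgt.
move=> [/andP[t_ge0 t_le] t_spec]; exists (cos t); split=> //.
  by rewrite cosK // in_itv /= t_ge0; lra.
by apply: cos_ge0_pihalf; lra.
Qed.

Lemma angles_perp F G t : complemented F -> complemented G ->
  angles dot F (perp G) (pi / 2 - t) <-> angles dot F G t.
Proof.
move=> Fc Gc; have Gc' := perp_complemented Gc.
rewrite !anglesP // cos_sqr_pihalfB rmorphB rmorph1 spectrum_perp //.
by rewrite subr_ge0 gerBl andbC.
Qed.

Lemma cos_sqr_neq0 (t : R) : 0 <= t <= pi / 2 -> t != pi / 2 ->
  rho (cos t ^+ 2) != 0.
Proof.
move=> t_itv t_neq; rewrite fmorph_eq0 sqrf_eq0 gt_eqF // cos_gt0_pihalf //.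
have := pi_gt0 R; case/andP: t_itv => t_ge0; rewrite le_eqVlt (negPf t_neq) /=.
by move=> t_lt pi_gt0; rewrite t_lt andbT; lra.
Qed.

Lemma angles_sym F G t : complemented F -> complemented G -> t != pi / 2 ->
  angles dot G F t <-> angles dot F G t.
Proof.
move=> Fc Gc t_neq; rewrite !anglesP //.
by split=> -[t_itv t_spec]; split=> //; apply/spectrum_sym => //; exact: cos_sqr_neq0.
Qed.

Local Notation eig F G l := (eigenspace_on F (proj F \o proj G) l).

(** The two branches of the definition agree: an angle that is not a point angle
    has the zero eigenspace, of dimension 0. *)
Lemma multiplicityE F G t : complemented F -> complemented G ->
  0 <= t <= pi / 2 ->
  multiplicity dot F G t = dimension (eig F G (rho (cos t ^+ 2))).
Proof.
move=> Fc Gc t_itv; rewrite /multiplicity.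
case: ifPn => // /asboolPn nonpoint.
rewrite (_ : eig F G _ = [set 0]) ?dimension0 //.
apply/seteqP; split=> [x Ex|x ->]; last first.
  split; first exact: Fc.1.1.
  rewrite scaler0; exact: (bounded_between0 Fc.1 (compression_bounded Fc Gc)).
apply: contrapT => x_neq0; apply: nonpoint.
have Ep : point_spectrum_on F (proj F \o proj G) (rho (cos t ^+ 2)) by exists x.
split=> //; apply/anglesP => //; split=> //.
by apply: point_spectrum_spectrum => //; exact: Fc.1.
Qed.

Lemma multiplicity_perp F G t : complemented F -> complemented G ->
  0 <= t <= pi / 2 ->
  multiplicity dot F (perp G) (pi / 2 - t) = multiplicity dot F G t.
Proof.
move=> Fc Gc t_itv; have Gc' := perp_complemented Gc.
rewrite !multiplicityE //; last by rewrite subr_ge0 gerBl andbC.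
congr (dimension _); rewrite cos_sqr_pihalfB rmorphB rmorph1.
apply/seteqP; split=> x [Fx Ex]; split=> //.
  move: Ex; rewrite compression_perp // scalerBl scale1r => /addrI.
  exact: oppr_inj.
by rewrite compression_perp // Ex scalerBl scale1r.
Qed.

Lemma eigenspace_linear F G l : complemented F -> complemented G ->
  linear_set (eig F G l).
Proof.
move=> Fc Gc; split.
  split; first exact: Fc.1.1.
  rewrite scaler0; exact: (bounded_between0 Fc.1 (compression_bounded Fc Gc)).
move=> a x y [Fx Ex] [Fy Ey]; have [_ TP _] := compression_bounded Fc Gc.
split; first exact: Fc.1.2.
by rewrite TP // Ex Ey scalerDr !scalerA mulrC.
Qed.

(** [P] maps the eigenspace of [Q P] to that of [P Q], with inverse [l^-1 Q]. *)
Lemma dimension_eigenspace_sym F G l : complemented F -> complemented G -> l != 0 ->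
  dimension (eig G F l) = dimension (eig F G l).
Proof.
move=> Fc Gc l_neq0.
have PZ V (Vc : complemented V) a x : proj V (a *: x) = a *: proj V x.
  by rewrite -!(projector_funE Vc) linearZ.
pose f := projector_fun Fc; pose g : {linear H -> H} := l^-1 \*: projector_fun Gc.
apply: (@dimension_iso _ _ _ _ f g); try exact: eigenspace_linear.
- by move=> x [Gx /= Ex]; split; [exact: projector_in|rewrite /= Ex PZ].
- move=> x [Fx /= Ex]; split=> /=.
    by apply: (linear_setZ _ Gc.1); exact: projector_in.
  by rewrite PZ // PZ // Ex PZ // scalerA mulrC -scalerA.
- by move=> x [Gx /= ->]; rewrite scalerA mulVf // scale1r.
- by move=> x [Fx /= Ex]; rewrite /f /= PZ // Ex scalerA mulVf // scale1r.
Qed.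

Lemma multiplicity_sym F G t : complemented F -> complemented G ->
  0 <= t <= pi / 2 -> t != pi / 2 ->
  multiplicity dot G F t = multiplicity dot F G t.
Proof.
move=> Fc Gc t_itv t_neq; rewrite !multiplicityE //.
by apply: dimension_eigenspace_sym => //; exact: cos_sqr_neq0.
Qed.

(** For [x] in [F], [<P Q x, x> = |Q x|^2], so [P Q x = 0] forces [Q x = 0]. *)
Lemma multiplicity_pihalf F G : complemented F -> complemented G ->
  multiplicity dot F G (pi / 2) = dimension (F `&` perp G).
Proof.
move=> Fc Gc; rewrite multiplicityE //; last first.
  by rewrite lexx andbT divr_ge0 // pi_ge0.
congr (dimension _); rewrite cos_pihalf expr0n rmorph0.
apply/seteqP; split=> x [Fx /= Ex]; split=> //.
  apply: (projector0 Gc x).1; apply: dot_eq0.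
  move: Ex; rewrite scale0r => Ex.
  rewrite -(projector_dot Gc) -{2}(projector_id Fc Fx) -(projector_sym Fc) Ex.
  exact: dot0l.
by rewrite scale0r /= (projector0 Gc x).2 //; apply/(projector0 Fc) => y _; exact: dot0l.
Qed.

(** The angle 0 between [F] and [G] is the angle [pi / 2] between [F] and the
    orthocomplement of [G]. *)
Lemma multiplicity_zero F G : complemented F -> complemented G ->
  multiplicity dot F G 0 = dimension (F `&` G).
Proof.
move=> Fc Gc; have pi2 : 0 <= pi / 2 :> R by rewrite divr_ge0 // pi_ge0.
rewrite -multiplicity_perp ?lexx ?subr0 // multiplicity_pihalf ?perp_perp //.
exact: perp_complemented.
Qed.

Lemma pihalf_subP (S : set R) t : pihalf_sub S t <-> S (pi / 2 - t).
Proof.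
split=> [[s Ss <-]|St]; first by rewrite subKr.
by exists (pi / 2 - t); rewrite // subKr.
Qed.

Lemma angles_perpr F G t : complemented F -> complemented G ->
  angles dot F (perp G) t <-> angles dot F G (pi / 2 - t).
Proof. by move=> Fc Gc; rewrite -(angles_perp (pi / 2 - t) Fc Gc) subKr. Qed.

Lemma pihalfB_eq (t : R) : (pi / 2 - t == pi / 2) = (t == 0).
Proof. by rewrite -subr_eq0 addrAC subrr add0r oppr_eq0. Qed.

Lemma angles_sym_perpr F G t : complemented F -> complemented G -> t != 0 ->
  angles dot G (perp F) t <-> angles dot F G (pi / 2 - t).
Proof.
by move=> Fc Gc t_neq; rewrite angles_perpr // angles_sym // pihalfB_eq.
Qed.

Lemma angles_sym_perpl F G t : complemented F -> complemented G -> t != pi / 2 ->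
  angles dot (perp G) F t <-> angles dot F G (pi / 2 - t).
Proof.
move=> Fc Gc t_neq; rewrite angles_sym ?angles_perpr //.
exact: perp_complemented.
Qed.

Lemma multiplicity_perpr F G t : complemented F -> complemented G ->
  0 < t < pi / 2 ->
  multiplicity dot F (perp G) t = multiplicity dot F G (pi / 2 - t).
Proof.
move=> Fc Gc /andP[t0 t1]; rewrite -[t in LHS](subKr (pi / 2)).
by rewrite multiplicity_perp // subr_ge0 gerBl !ltW.
Qed.

End InnerProduct.

Theorem theorem2p6 (R : realType) (k : scalar_kind)
    (H : completeNormedModType (scalars R k))
    (dot : {dot H for conj_scalar R k})
    (norm_dot : forall x : H, `|x| ^+ 2 = dot x x)
    (F G : set H)
    (F_subspace : is_subspace F) (F_nontrivial : F <> [set 0])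
    (F_proper : F <> setT)
    (G_subspace : is_subspace G) (G_nontrivial : G <> [set 0])
    (G_proper : G <> setT) :
  let F' := orthocomplement dot F in
  let G' := orthocomplement dot G in
  let Theta := angles dot in
  let mult := multiplicity dot in
  let M00 := F `&` G in
  let M01 := F `&` G' in
  let M10 := F' `&` G in
  let M11 := F' `&` G' in
  let zero : set R := [set 0] in
  let pihalf : set R := [set pi / 2] in
  [/\ (* sets of angles *)
      [/\ Theta F G' = pihalf_sub (Theta F G),
          Theta G F `\` pihalf = Theta F G `\` pihalf,
          Theta F' G `\` (zero `|` pihalf)
            = pihalf_sub (Theta F G `\` (zero `|` pihalf))
        & Theta F' G' `\` (zero `|` pihalf)
            = Theta F G `\` (zero `|` pihalf)]
      /\
      [/\ Theta G F' `\` zero = pihalf_sub (Theta F G `\` pihalf),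
          Theta G' F `\` pihalf = pihalf_sub (Theta F G `\` zero)
        & Theta G' F' `\` zero = Theta F G `\` zero],
      (* multiplicities of 0 and pi/2 *)
      [/\ mult F G 0 = dimension M00 /\ mult F G (pi / 2) = dimension M01,
          mult F G' 0 = dimension M01 /\ mult F G' (pi / 2) = dimension M00,
          mult F' G 0 = dimension M10 /\ mult F' G (pi / 2) = dimension M11
        & mult F' G' 0 = dimension M11 /\ mult F' G' (pi / 2) = dimension M10]
      /\
      [/\ mult G F 0 = dimension M00 /\ mult G F (pi / 2) = dimension M10,
          mult G F' 0 = dimension M10 /\ mult G F' (pi / 2) = dimension M00,
          mult G' F 0 = dimension M01 /\ mult G' F (pi / 2) = dimension M11
        & mult G' F' 0 = dimension M11 /\ mult G' F' (pi / 2) = dimension M01]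
    & (* multiplicities in the open interval (0, pi/2) *)
      forall theta : R, 0 < theta < pi / 2 ->
        [/\ mult F' G' theta = mult F G theta,
            mult G F theta = mult F G theta
          & mult G' F' theta = mult F G theta]
        /\
        [/\ mult F G' (pi / 2 - theta) = mult F G theta,
            mult F' G (pi / 2 - theta) = mult F G theta,
            mult G F' (pi / 2 - theta) = mult F G theta
          & mult G' F (pi / 2 - theta) = mult F G theta]].
Proof.
move=> F' G' Theta mult M00 M01 M10 M11 zero pihalf.
have Fc := subspace_complemented norm_dot F_subspace.
have Gc := subspace_complemented norm_dot G_subspace.
have Fc' : complemented dot F' := perp_complemented norm_dot Fc.
have Gc' : complemented dot G' := perp_complemented norm_dot Gc.
have FK : orthocomplement dot F' = F := perp_perp norm_dot Fc.
have GK : orthocomplement dot G' = G := perp_perp norm_dot Gc.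
have pihalfB0 (t : R) : (pi / 2 - t == 0) = (t == pi / 2).
  by rewrite subr_eq0 eq_sym.
have perpr A B t : complemented dot A -> complemented dot B ->
    Theta A (orthocomplement dot B) t <-> Theta A B (pi / 2 - t).
  exact: angles_perpr.
have sym A B t : complemented dot A -> complemented dot B -> t != pi / 2 ->
    Theta B A t <-> Theta A B t.
  exact: angles_sym.
have sym_perpr A B t : complemented dot A -> complemented dot B -> t != 0 ->
    Theta B (orthocomplement dot A) t <-> Theta A B (pi / 2 - t).
  exact: angles_sym_perpr.
have sym_perpl A B t : complemented dot A -> complemented dot B -> t != pi / 2 ->
    Theta (orthocomplement dot B) A t <-> Theta A B (pi / 2 - t).
  exact: angles_sym_perpl.
have perpl t : t != 0 -> t != pi / 2 -> Theta F' G t <-> Theta F G (pi / 2 - t).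
  by move=> t0 t1; rewrite (sym G F') // sym_perpr.
have ends t : ~ (zero `|` pihalf) t <-> t != 0 /\ t != pi / 2.
  by rewrite /zero /pihalf /setU /= not_orP; split=> -[/eqP ? /eqP].
have endsB t : ~ (zero `|` pihalf) (pi / 2 - t) <-> t != 0 /\ t != pi / 2.
  by rewrite ends pihalfB0 pihalfB_eq and_comm.
split.
- split; split.
  + by apply/seteqP; split=> t /=;
      [rewrite pihalf_subP => /perpr; exact|rewrite pihalf_subP => ?; exact/perpr].
  + by apply/seteqP; split=> t [Tt /eqP t1]; split; try exact/eqP; exact/sym.
  + apply/seteqP; split=> t.
      by move=> [Tt /ends[t0 t1]]; apply/pihalf_subP; split;
        [apply/perpl|apply/endsB].
    by move=> /pihalf_subP[Tt /endsB[t0 t1]]; split; [apply/perpl|apply/ends].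
  + have perplr t : t != 0 -> t != pi / 2 -> Theta F' G' t <-> Theta F G t.
      move=> t0 t1; rewrite perpr // perpl ?subKr ?pihalfB0 //.
      by rewrite pihalfB_eq.
    by apply/seteqP; split=> t [Tt te]; have [t0 t1] := (ends t).1 te; split=> //;
      apply/perplr.
  + apply/seteqP; split=> t.
      move=> [Tt /eqP t0]; apply/pihalf_subP; split; first exact/sym_perpr.
      by apply/eqP; rewrite pihalfB_eq.
    move=> /pihalf_subP[Tt /eqP]; rewrite pihalfB_eq => t0.
    by split; [exact/sym_perpr|exact/eqP].
  + apply/seteqP; split=> t.
      move=> [Tt /eqP t0]; apply/pihalf_subP; split; first exact/sym_perpl.
      by apply/eqP; rewrite pihalfB0.
    move=> /pihalf_subP[Tt /eqP]; rewrite pihalfB0 => t0.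
    by split; [exact/sym_perpl|exact/eqP].
  + have sym_perplr t : t != 0 -> Theta G' F' t <-> Theta F G t.
      by move=> t0; rewrite perpr // sym_perpl ?subKr // pihalfB_eq.
    by apply/seteqP; split=> t [Tt te]; have /eqP t0 := te; split=> //;
      apply/sym_perplr.
- by split; split; split;
    rewrite /mult ?multiplicity_zero ?multiplicity_pihalf // ?FK ?GK // setIC.
move=> t t_itv.
have u_itv : 0 < pi / 2 - t < pi / 2.
  by case/andP: t_itv => t0 t1; rewrite subr_gt0 t1 gtrBl.
have mswap A B s : complemented dot A -> complemented dot B ->
    0 < s < pi / 2 -> mult B A s = mult A B s.
  move=> Ac Bc /andP[s0 s1].
  by apply: multiplicity_sym => //; rewrite ?ltW ?lt_eqF.
have mperpr A B s : complemented dot A -> complemented dot B ->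
    0 < s < pi / 2 -> mult A (orthocomplement dot B) s = mult A B (pi / 2 - s).
  exact: multiplicity_perpr.
have FG' : mult F G' (pi / 2 - t) = mult F G t by rewrite mperpr ?subKr.
have GF' : mult G F' (pi / 2 - t) = mult F G t.
  by rewrite mperpr ?subKr ?(mswap F G).
have F'G : mult F' G (pi / 2 - t) = mult F G t by rewrite (mswap G F').
have G'F : mult G' F (pi / 2 - t) = mult F G t by rewrite (mswap F G').
split; split=> //; [by rewrite mperpr|exact: mswap|by rewrite mperpr].
Qed.
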